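(* Already on trees there are two infinite hierarchies of LCL problems with respect to the existential mending volume: (i) for infinitely many values $0<\alpha\le 1$ there is an LCL problem $\Pi$ on trees whose existential mending volume is $\Theta(n^{\alpha})$; and (ii) for infinitely many values $k\ge 1$ there is an LCL problem $\Pi$ on trees whose existential mending volume is $\Theta(\log^{k} n)$.
   Context: All graphs have maximum degree bounded by a constant. $N_r(v)$ denotes the radius-$r$ neighborhood of $v$. A locally checkable labeling (LCL) problem $\Pi=(\Sigma,\mathcal G,\phi)$ consists of a finite label set $\Sigma$, a class $\mathcal G$ of input graphs, and a local verifier $\phi$ of some constant radius $r$: $\phi$ maps $(G,\lambda,v)$ ($G\in\mathcal G$, $\lambda$ a labeling of the vertices of $G$, $v$ a vertex) to happy or unhappy, and its value depends only on the isomorphism type of the labeled radius-$r$ neighborhood of $v$. A solution is a labeling $\lambda:V(G)\to\Sigma$ for which every vertex is happy. A partial solution is a labeling $\lambda:V(G)\to\Sigma\sqcup\{\bot\}$ such that every vertex $v$ with no $\bot$-labeled vertex within distance $r$ is happy (in the sense of $\phi$); vertices that see a $\bot$ within distance $r$ are automatically happy. A hole of $\lambda$ is a vertex labeled $\bot$. A mend of $\lambda$ at a hole $v$ is a partial solution $\lambda'$ such that $\lambda'(v)\ne\bot$ and $\lambda'(u)\neq\bot$ whenever $\lambda(u)\ne\bot$. It is assumed that mends always exist. The existential mending volume on instances with $n$ vertices is $\max_{G,\lambda,v}\min\{|\{u:\lambda(u)\ne\lambda'(u)\}| : \lambda' \text{ a mend of }\lambda\text{ at }v\}$, where $G\in\mathcal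 G$ ranges over $n$-vertex instances, $\lambda$ over partial solutions and $v$ over holes of $\lambda$; it is regarded as a function of $n$. *)

(* Defs.v *)
From mathcomp Require Import all_boot all_order all_algebra.
From mathcomp Require Import all_classical all_reals all_analysis.

Set Implicit Arguments.
Unset Strict Implicit.
Unset Printing Implicit Defensive.

(* Finite simple graphs on the vertex set 'I_n, given by their set of adjacent
   pairs.  Graphs matter only up to isomorphism, so the vertex set can be fixed;
   this makes [graph n] a finType, over which a maximum can be taken. *)
Definition simple n (E : {set 'I_n * 'I_n}) : bool :=
  [forall u, (u, u) \notin E] &&
  [forall u, forall v, ((u, v) \in E) == ((v, u) \in E)].

Definition graph n := {E : {set 'I_n * 'I_n} | simple E}.

Definition adj n (G : graph n) : rel 'I_n := fun u v => (u, v) \in val G.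

Definition max_degree_le n (G : graph n) (D : nat) : Prop :=
  forall v, #|[set u | adj G v u]| <= D.

Definition graph_connected n (G : graph n) : Prop :=
  0 < n /\ forall u v, connect (adj G) u v.

Definition graph_acyclic n (G : graph n) : Prop :=
  forall c : seq 'I_n, 2 < size c -> ~ ucycle (adj G) c.

Definition is_tree n (G : graph n) : Prop := graph_connected G /\ graph_acyclic G.

(* The vertices at distance at most r from v. *)
Fixpoint neighborhood n (G : graph n) (r : nat) (v : 'I_n) : {set 'I_n} :=
  if r is r'.+1 then
    neighborhood G r' v :|:
      [set w | [exists u in neighborhood G r' v, adj G u w]]
  else [set v].

Definition labeling (S : Type) n := {ffun 'I_n -> S}.

(* The labeled radius-r neighborhoods of v in G and of w in H, as induced
   subgraphs rooted at v and at w, are isomorphic. *)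
Definition same_view (S : Type) r n (G : graph n) (l : labeling S n) (v : 'I_n)
    m (H : graph m) (k : labeling S m) (w : 'I_m) : Prop :=
  exists f : 'I_n -> 'I_m,
    [/\ f v = w,
        {in neighborhood G r v &, injective f},
        f @: neighborhood G r v = neighborhood H r w,
        {in neighborhood G r v &, forall x y, adj H (f x) (f y) = adj G x y}
      & {in neighborhood G r v, forall x, k (f x) = l x}].

Record lcl := LCL {
  label : finType;
  inputs : forall n, graph n -> Prop;
  radius : nat;
  happy : forall n, graph n -> labeling label n -> 'I_n -> bool;
  happy_local : forall n (G : graph n) (l : labeling label n) (v : 'I_n)
      m (H : graph m) (k : labeling label m) (w : 'I_m),
    inputs G -> inputs H -> same_view radius G l v H k w ->
    happy G l v = happy H k w }.

(* The inputs are exactly all the trees of maximum degree at most some constant. *)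
Definition on_trees (P : lcl) : Prop :=
  exists D, forall n (G : graph n), inputs P G <-> is_tree G /\ max_degree_le G D.

Section Mending.
Variables (P : lcl) (n : nat) (G : graph n).

(* [None] stands for the symbol bot. *)
Definition partial_labeling := labeling (option (label P)) n.

Implicit Types (l k : partial_labeling) (v : 'I_n).

Definition hole l v : bool := l v == None.

Definition sees_hole l v : bool :=
  [exists u in neighborhood G (radius P) v, hole l u].

(* If v sees no hole, a total labeling agreeing with l around v exists, and by
   locality all of them give v the same verdict. *)
Definition partial_solution l : Prop :=
  forall v, ~~ sees_hole l v ->
  forall c : labeling (label P) n,
    {in neighborhood G (radius P) v, forall u, l u = Some (c u)} ->
    happy G c v.

Definition is_mend l v k : Prop :=
  [/\ partial_solution k, ~~ hole k v & forall u, ~~ hole l u -> ~~ hole k u].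

Definition changes l k : nat := #|[set u | l u != k u]|.

(* The number of changes never exceeds n, so starting the minimum from n does
   not affect it as soon as there is a mend. *)
Definition mending_cost l v : nat :=
  \big[minn/n]_(k : partial_labeling | `[< is_mend l v k >]) changes l k.

End Mending.

Definition mendable (P : lcl) : Prop :=
  forall n (G : graph n) (l : partial_labeling P n) (v : 'I_n),
    inputs P G -> partial_solution G l -> hole l v ->
    exists k, is_mend G l v k.

Definition mending_volume (P : lcl) (n : nat) : nat :=
  \max_(G : graph n | `[< inputs P G >])
    \max_(l : partial_labeling P n | `[< partial_solution G l >])
      \max_(v | hole l v) mending_cost G l v.

Local Open Scope classical_set_scope.
Local Open Scope ring_scope.

Definition tree_problem_with_volume (R : realType) (P : lcl) (g : nat -> R) :
    Prop :=
  [/\ on_trees P, mendable P &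
      (fun n => (mending_volume P n)%:R : R^o) =Theta_\oo (g : nat -> R^o)].

(* Main.v *)
Require Import Defs.
From mathcomp Require Import all_boot all_order all_algebra.
From mathcomp Require Import all_classical all_reals all_analysis.
From mathcomp Require Import zify ring lra.

Set Implicit Arguments.
Unset Strict Implicit.
Unset Printing Implicit Defensive.

(** Fix [D], [K] and a map [s] with [s j <= j].  Vertices carry labels
    [0, ..., K]; a vertex of degree greater than [D] with label [j > 0] must have
    two neighbors labeled at least [j] and, if [s j > 0], three neighbors labeled
    at least [s j]; vertices of degree at least [D + 2] must have label [K].
    Raising labels never hurts, so a hole is mended by feeding labels outwards:
    a vertex that receives a label [j] from a neighbor passes [j] and [s j] on to
    two other neighbors, chosen with the cheapest branches, until the flow reaches
    vertices of degree at most [D].  The worst case is a complete [D]-ary tree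
    labeled [0] everywhere, except for a hole at its root.

    With [K = 1], [s = id] and [D = 2 ^ k], the flow enters 2 of at least [2 ^ k]
    branches at every step, which costs [Theta (n ^ (1 / k))].  With
    [s j = j - 1] and [D = 3], the flow obeys Pascal's recursion along the
    logarithmic depth of the tree, which costs [Theta (log ^ K n)]. *)

(** * Neighbors and the feeding problems *)

Definition neighbor_count n (G : graph n) (P : pred 'I_n) (v : 'I_n) : nat :=
  #|[set u | adj G v u & P u]|.

Definition degree n (G : graph n) (v : 'I_n) : nat := #|[set u | adj G v u]|.

Section Graphs.
Variables (n : nat) (G : graph n).

Lemma adjxx v : adj G v v = false.
Proof. by have /andP[/forallP/(_ v)/negbTE] := valP G. Qed.

Lemma adjC u v : adj G u v = adj G v u.
Proof. by have /andP[_ /forallP/(_ u)/forallP/(_ v)/eqP] := valP G. Qed.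

Lemma in_neighborhood1 v u : (u \in neighborhood G 1 v) = (u == v) || adj G v u.
Proof.
rewrite /= !inE; congr (_ || _); apply/existsP/idP => [[w]|Gvu].
  by rewrite inE => /andP[/eqP->].
by exists v; rewrite inE eqxx.
Qed.

Lemma neighbor_countS (P Q : pred 'I_n) v :
  subpred P Q -> neighbor_count G P v <= neighbor_count G Q v.
Proof.
by move=> PQ; apply/subset_leq_card/fintype.subsetP => u; rewrite !inE => /andP[-> /PQ].
Qed.

Lemma eq_in_neighbor_count (P Q : pred 'I_n) v :
  (forall u, adj G v u -> P u = Q u) -> neighbor_count G P v = neighbor_count G Q v.
Proof.
by move=> PQ; apply: eq_card => u; rewrite !inE; case Gvu: (adj G v u); rewrite //= PQ.
Qed.

End Graphs.

Section View.
Variables (S : Type) (n m : nat) (G : graph n) (H : graph m).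
Variables (l : labeling S n) (k : labeling S m) (v : 'I_n) (w : 'I_m).
Hypothesis view : same_view 1 G l v H k w.

Lemma view_label : k w = l v.
Proof.
by case: view => f [<- _ _ _ ->] //; rewrite in_neighborhood1 eqxx.
Qed.

Lemma view_neighbor_count (P : pred S) :
  neighbor_count H (fun u => P (k u)) w = neighbor_count G (fun u => P (l u)) v.
Proof.
case: view => f [fv finj fN fadj fl].
have vN : v \in neighborhood G 1 v by rewrite in_neighborhood1 eqxx.
have sub : {subset [set u | adj G v u & P (l u)] <= neighborhood G 1 v}.
  by move=> u; rewrite inE in_neighborhood1 => /andP[-> _]; rewrite orbT.
rewrite /neighbor_count -(card_in_imset (sub_in2 sub finj)).
apply: eq_card => x; rewrite inE; apply/andP/imsetP => [[Hwx Px]|[u]].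
  have : x \in f @: neighborhood G 1 v by rewrite fN in_neighborhood1 Hwx orbT.
  case/imsetP => u uN xE; exists u => //.
  by rewrite inE -fadj // fv -xE Hwx -fl // -xE.
move=> uin; have uN := sub _ uin; move: uin.
by rewrite inE => /andP[Gvu Pu] ->; rewrite -fv fadj // fl.
Qed.

End View.

Lemma view_degree (S : Type) n m (G : graph n) (H : graph m) (l : labeling S n)
    (k : labeling S m) v w :
  same_view 1 G l v H k w -> degree H w = degree G v.
Proof.
move=> /view_neighbor_count/(_ xpredT); rewrite /neighbor_count /degree => E.
by under eq_finset do rewrite -[adj H w _]andbT;
  rewrite E; apply: eq_card => u; rewrite !inE andbT.
Qed.

Section Problem.
Variables (D K : nat) (s : nat -> nat).

(** The level [c] is separate from the label [x v]: a supply serves [u] at its own level [y u] under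
    labelings [Y] that may exceed [y]. *)
Definition fed n (G : graph n) (x : 'I_n -> nat) (v : 'I_n) (c : nat) : bool :=
  ((0 < c) ==> (2 <= neighbor_count G (fun u => c <= x u) v)) &&
  ((0 < s c) ==> (3 <= neighbor_count G (fun u => s c <= x u) v)).

Definition feeding_happy n (G : graph n) (l : labeling 'I_K.+1 n) v : bool :=
  (D < degree G v) ==>
    fed G (fun u => l u) v (l v) && ((D.+1 < degree G v) ==> (l v == K :> nat)).

Definition bounded_tree n (G : graph n) : Prop :=
  is_tree G /\ max_degree_le G D.+2.

Lemma feeding_happy_local n (G : graph n) (l : labeling 'I_K.+1 n) (v : 'I_n)
    m (H : graph m) (k : labeling 'I_K.+1 m) (w : 'I_m) :
  bounded_tree G -> bounded_tree H -> same_view 1 G l v H k w ->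
  feeding_happy G l v = feeding_happy H k w.
Proof.
move=> _ _ view; rewrite /feeding_happy /fed (view_degree view) (view_label view).
by rewrite !(view_neighbor_count view (fun i => _ <= nat_of_ord i)).
Qed.

Definition feeding : lcl := LCL feeding_happy_local.

Lemma on_trees_feeding : on_trees feeding.
Proof. by exists D.+2. Qed.

End Problem.

(** * Branches of a tree *)

Section Branches.
Variables (n : nat) (G : graph n).
Hypothesis acyc : graph_acyclic G.

Definition adj_avoiding (p : 'I_n) : rel 'I_n :=
  fun x y => [&& adj G x y, x != p & y != p].

(** For [w] other than [p], this is the component of [w] once [p] is deleted. *)
Definition branch (p w : 'I_n) : {set 'I_n} := [set u | connect (adj_avoiding p) w u].

Lemma path_avoiding p x s :
  path (adj_avoiding p) x s -> path (adj G) x s /\ p \notin s.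
Proof.
elim: s x => //= y s IH x /andP[/and3P[xy _ yp] /IH[ys ps]].
by rewrite xy ys inE negb_or eq_sym yp ps.
Qed.

(** Otherwise a simple path from [z] to [z'] off [w] would close up through [w] to a cycle. *)
Lemma connect_neighbors w z z' :
  adj G w z -> adj G w z' -> connect (adj_avoiding w) z z' -> z = z'.
Proof.
move=> wz wz' /connectP[s0 p0 E]; case: (eqVneq z z') => // zz'.
move: E; case/shortenP: p0 => s /path_avoiding[ps ws] us _ E.
case: (@acyc (w :: z :: s)).
  by case: s ps ws us E => //= _ _ _ E; rewrite E eqxx in zz'.
apply/andP; split.
  by rewrite /= wz rcons_path ps -E adjC.
rewrite cons_uniq us inE (negbTE ws) orbF andbT.
by apply: contraTneq wz => <-; rewrite adjxx.
Qed.

Lemma branch_refl p w : w \in branch p w.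
Proof. by rewrite inE connect0. Qed.

(** A path from [z] off [w] cannot reach [p]: then [p] and [z] would be distinct neighbors of [w]
    joined off [w]. *)
Lemma sub_branch p w z : adj G p w -> adj G w z -> z != p ->
  branch w z \subset branch p w :\ w.
Proof.
move=> pw wz zp; apply/fintype.subsetP => u; rewrite !inE => /connectP[s ps ->].
have np : p \notin z :: s.
  apply/negP => /(path_connect ps).
  by move/connect_neighbors => /(_ wz); rewrite adjC pw => /(_ isT) /eqP; apply/negP.
have wp : w != p by apply: contraTneq pw => ->; rewrite adjxx.
have wz' : z != w by apply: contraTneq wz => ->; rewrite adjxx.
apply/andP; split.
  have [_ ws] := path_avoiding ps.
  have : last z s \in z :: s by rewrite mem_last.
  by apply: contraTneq => ->; rewrite inE negb_or eq_sym wz'.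
apply: (@connect_trans _ _ z).
  by apply: connect1; rewrite /adj_avoiding wz wp zp.
apply/connectP; exists s => //.
elim: s z ps np {wz zp wz'} => //= y s IH z /andP[/and3P[zy _ yw] ys].
rewrite !inE !negb_or => /and3P[pz py ps].
rewrite /adj_avoiding zy !(eq_sym _ p) pz py /= IH // inE negb_or py //.
Qed.

Lemma disjoint_branch w z z' : adj G w z -> adj G w z' -> z != z' ->
  [disjoint branch w z & branch w z'].
Proof.
move=> wz wz' zz'; apply/pred0P => u /=; apply/negP => /andP[]; rewrite !inE => zu z'u.
have csym : connect_sym (adj_avoiding w).
  by apply: sym_connect_sym => x y; rewrite /adj_avoiding adjC [(x != w) && _]andbC.
move/eqP: zz'; apply; apply: connect_neighbors wz wz' _.
by apply: connect_trans zu _; rewrite csym.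
Qed.

(** The branches beyond [w] are disjoint and miss [w] itself, which makes the inequality strict. *)
Lemma sum_branch p w : adj G p w ->
  \sum_(z in [set z | adj G w z && (z != p)]) #|branch w z| < #|branch p w|.
Proof.
move=> pw; rewrite (cardsD1 w (branch p w)) branch_refl add1n ltnS.
set Z := [set z | _].
have sZ z : z \in Z -> branch w z \subset branch p w :\ w.
  by rewrite inE => /andP[]; exact: sub_branch.
under eq_bigr do rewrite -sum1_card.
rewrite (exchange_big_dep (mem (branch p w :\ w))) /=; last first.
  by move=> z u /sZ /fintype.subsetP; apply.
rewrite -[leqRHS]sum1_card; apply: leq_sum => u _; rewrite sum1_card.
apply/card_le1_eqP => z z' /andP[+ zu] /andP[+ z'u].
rewrite !inE => /andP[wz _] /andP[wz' _].
apply/eqP/contraT; rewrite eq_sym => zz'; have /pred0P/(_ u) := disjoint_branch wz wz' zz'.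
by rewrite /= zu z'u.
Qed.

End Branches.

(** * Upper bound *)

Lemma bigmax_attained (I : finType) (P : pred I) (F : I -> nat) :
  0 < \max_(i | P i) F i -> exists2 i, P i & \max_(i | P i) F i = F i.
Proof.
case: (pickP P) => [i Pi _|P0]; last by rewrite big_pred0.
have [|j Pj ->] := @eq_bigmax_cond _ P F; first by apply/card_gt0P; exists i.
by exists j.
Qed.

Lemma leq_card_bigcup (I T : finType) (P : pred I) (F : I -> {set T}) :
  #|\bigcup_(i | P i) F i| <= \sum_(i | P i) #|F i|.
Proof.
elim/big_rec2: _ => [|i c A _ le]; first by rewrite cards0.
by apply: leq_trans (leq_card_setU _ _) _; rewrite leq_add2l.
Qed.

Lemma leq_neighbor_count n (G : graph n) (t : seq 'I_n) (P : pred 'I_n) v :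
  uniq t -> all (fun u => adj G v u && P u) t -> size t <= neighbor_count G P v.
Proof.
move=> /card_uniqP <- /allP tP; apply/subset_leq_card/fintype.subsetP => u /tP.
by rewrite inE.
Qed.

Lemma fedS s n (G : graph n) (x x' : 'I_n -> nat) v c :
  (forall u, x u <= x' u) -> fed s G x v c -> fed s G x' v c.
Proof.
move=> xx' /andP[/implyP h1 /implyP h2].
apply/andP; split; apply/implyP => c0; [move: (h1 c0)|move: (h2 c0)] => /leq_trans; apply;
  by apply: neighbor_countS => u /leq_trans; apply.
Qed.

Section UpperBound.
Variables (D K : nat) (s : nat -> nat) (n : nat) (G : graph n).
(** [Q j m W] reads: cost [W] is affordable for feeding [j] into a branch of [m] vertices. Each
    hierarchy brings its own [Q]. In [Q_step] the branches [z1] and [z2] receive [j] and [s j], and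
    the successor pays for the vertex that passes them on. *)
Variable Q : nat -> nat -> nat -> Prop.
Hypotheses (acyc : graph_acyclic G) (degG : max_degree_le G D.+2).
Hypotheses (D_gt1 : 1 < D) (s_le : forall j, s j <= j).
Hypothesis Q_zero : forall m, 0 < m -> Q 0 m 0.
Hypothesis Q_one : forall j m, 0 < j -> 0 < m -> Q j m 1.
Hypothesis Q_step : forall (Z : {set 'I_n}) (m : 'I_n -> nat) (W : 'I_n -> nat -> nat) j M,
  D <= #|Z| -> 0 < j <= K ->
  (forall z i, z \in Z -> i <= K -> Q i (m z) (W z i)) ->
  \sum_(z in Z) m z < M ->
  exists z1 z2, [/\ z1 \in Z, z2 \in Z, z1 != z2 & Q j M (W z1 j + W z2 (s j)).+1].

(* Quantifying over all larger labelings makes such supplies stable under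
   pointwise maxima. *)
Definition supply (y : 'I_n -> nat) (p w : 'I_n) (j : nat) : Prop :=
  [/\ forall u, y u <= j, j <= y w &
      forall Y : 'I_n -> nat, (forall u, y u <= Y u) -> j <= Y p ->
        forall u, 0 < y u -> D < degree G u -> fed s G Y u (y u)].

(** Induction on the size of the branch. If [w] has large degree, then [p] and [z1] are its two
    neighbors at level [j], and [p], [z1], [z2] its three at level [s j]. The two supplies beyond
    [w] are merged by pointwise maximum, so that their costs add. *)
Lemma branch_supply p w j : adj G p w -> j <= K ->
  exists yW : ('I_n -> nat) * nat,
    [/\ supply yW.1 p w j, #|[set u | 0 < yW.1 u]| <= yW.2 & Q j #|branch G p w| yW.2].
Proof.
have [N] := ubnP #|branch G p w|; elim: N => // N IH in p w j *.
rewrite ltnS => brN pw jK.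
have br0 : 0 < #|branch G p w| by apply/card_gt0P; exists w; exact: branch_refl.
have [->|j0] := posnP j.
  exists (fun=> 0, 0) => /=; split; [by []| |exact: Q_zero].
  by rewrite eq_card0 // => u; rewrite inE.
have [degw|degw] := leqP (degree G w) D.
  exists (fun u => if u == w then j else 0, 1) => /=; split; last exact: Q_one.
    split; first by move=> u; case: ifP.
      by rewrite eqxx.
    move=> Y _ _ u; case: eqP => // -> _; by rewrite ltnNge degw.
  apply: leq_trans (_ : #|[set w]| <= 1); last by rewrite cards1.
  apply/subset_leq_card/fintype.subsetP => u; rewrite !inE.
  by case: eqP.
set Z := [set z | adj G w z && (z != p)].
have DZ : D <= #|Z|.
  move: degw; rewrite /degree (cardsD1 p) inE adjC pw add1n ltnS => /leq_trans; apply.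
  by apply/eq_leq/eq_card => u; rewrite !inE andbC.
have sumZ := sum_branch acyc pw.
(* [Q_step] takes a cost function on all branches and labels, so supplies are chosen for all pairs
   at once, with dummies out of range. *)
have /choice[f fP] : forall zi : 'I_n * nat, exists yW : ('I_n -> nat) * nat,
    zi.1 \in Z -> zi.2 <= K ->
    [/\ supply yW.1 w zi.1 zi.2, #|[set u | 0 < yW.1 u]| <= yW.2
       & Q zi.2 #|branch G w zi.1| yW.2].
  case=> z i /=; have [zZ|] := boolP (z \in Z); last by exists (fun=> 0, 0).
  have [iK|] := leqP i K; last by exists (fun=> 0, 0).
  have [|||yW yWP] := IH w z i; last by exists yW.
  - apply: leq_trans brN; apply: leq_ltn_trans sumZ.
    by rewrite (bigD1 z) //= leq_addr.
  - by move: zZ; rewrite inE => /andP[].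
  - by [].
have [||z1 [z2 [z1Z z2Z z12 Qj]]] := Q_step (W := fun z i => (f (z, i)).2) (j := j) DZ _ _ sumZ.
- by rewrite j0 jK.
- by move=> z i zZ iK; have [] := fP (z, i) zZ iK.
have [[y1le y1z y1P] y1W _] := fP (z1, j) z1Z jK.
have [[y2le y2z y2P] y2W _] := fP (z2, s j) z2Z (leq_trans (s_le j) jK).
move: Qj y1le y1z y1P y1W y2le y2z y2P y2W => /=.
move: (f (z1, j)) (f (z2, s j)) => [y1 W1] [y2 W2] /= Qj y1le y1z y1P y1W y2le y2z y2P y2W.
exists (fun u => maxn (if u == w then j else 0) (maxn (y1 u) (y2 u)), (W1 + W2).+1).
split => //=.
  split.
  - move=> u; rewrite !geq_max y1le (leq_trans (y2le u)) // ?andbT.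
    by case: ifP.
  - by rewrite eqxx leq_maxl.
  move=> Y yY jp.
  have jw : j <= Y w by apply: leq_trans (yY w); rewrite eqxx leq_maxl.
  have y1Y u : y1 u <= Y u.
    by apply: leq_trans (yY u); rewrite !leq_max leqnn ?orbT.
  have y2Y u : y2 u <= Y u.
    by apply: leq_trans (yY u); rewrite !leq_max leqnn ?orbT.
  move=> u.
  have wfed : fed s G Y w j.
    move: z1Z z2Z; rewrite !inE => /andP[wz1 z1p] /andP[wz2 z2p].
    have sj := s_le j.
    apply/andP; split; apply/implyP => _.
      apply: (@leq_neighbor_count _ _ [:: p; z1]) => /=.
        by rewrite inE eq_sym z1p.
      by rewrite adjC pw wz1 jp (leq_trans y1z).
    apply: (@leq_neighbor_count _ _ [:: p; z1; z2]) => /=.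
      by rewrite !inE !(eq_sym p) !negb_or z1p z2p z12.
    rewrite adjC pw wz1 wz2 (leq_trans sj jp) (leq_trans y2z (y2Y z2)).
    by rewrite (leq_trans sj (leq_trans y1z (y1Y z1))).
  (* The maximum at [u] is attained by the label [j] of [w], by [y1] or by [y2]; the feeding
     property of that one applies to [Y]. *)
  case: (leqP (y1 u) (y2 u)) => h1.
    case: ifP => [/eqP->|_]; last first.
      by rewrite max0n; apply: y2P => //; exact: leq_trans (s_le j) jw.
    case: (leqP j (y2 w)) => _ //; by apply: y2P => //; exact: leq_trans (s_le j) jw.
  case: ifP => [/eqP->|_]; last by rewrite max0n; exact: y1P.
  by case: (leqP j (y1 w)) => _ //; apply: y1P.
rewrite -addn1 addnC.
apply: leq_trans (_ : #|[set w] :|: ([set u | 0 < y1 u] :|: [set u | 0 < y2 u])| <= _).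
  apply/subset_leq_card/fintype.subsetP => u; rewrite !inE.
  by case: eqP => //= _; rewrite max0n leq_max.
apply: leq_trans (leq_card_setU _ _) _; rewrite cards1 leq_add2l.
by apply: leq_trans (leq_card_setU _ _) _; apply: leq_add.
Qed.

Variable B : nat.
Hypothesis Q_bound : forall m W, m <= n -> Q K m W -> W <= B.

(** Filling [v] may expose any vertex of its closed neighborhood to the verifier, so all of these
    get the top label [K], with a supply into each branch around them. There are at most [D + 3] of
    them, each paying for itself and at most [D + 2] branches. *)
Lemma ball_supply v : exists y : 'I_n -> nat,
  [/\ forall u, y u <= K,
      forall u, u \in neighborhood G 1 v -> y u = K,
      forall Y : 'I_n -> nat, (forall u, y u <= Y u) ->
        forall u, 0 < y u -> D < degree G u -> fed s G Y u (y u)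
    & #|[set u | 0 < y u]| <= D.+3 * (1 + D.+2 * B)].
Proof.
have /choice[f fP] : forall uz : 'I_n * 'I_n, exists y : 'I_n -> nat,
    adj G uz.1 uz.2 ->
    supply y uz.1 uz.2 K /\ #|[set u | 0 < y u]| <= B.
  case=> u z /=; have [uz|] := boolP (adj G u z); last by exists (fun=> 0).
  have [[y W] [/= h1 h2 /Q_bound h3]] := branch_supply uz (leqnn K).
  exists y => _; split => //; apply: leq_trans h2 (h3 _).
  by rewrite -[leqRHS]card_ord max_card.
pose N := neighborhood G 1 v.
pose y t := \max_(u in N) maxn (if t == u then K else 0) (\max_(z | adj G u z) f (u, z) t).
have fle u z t : adj G u z -> f (u, z) t <= K.
  by move=> uz; have [[]] := fP (u, z) uz.
have yle u : y u <= K.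
  apply/bigmax_leqP => w _; rewrite geq_max; apply/andP; split; first by case: ifP.
  by apply/bigmax_leqP => z; apply: fle.
have yN u : u \in N -> y u = K.
  move=> uN; apply/eqP; rewrite eqn_leq yle /= /y (bigD1 u) //=.
  by rewrite eqxx !leq_max leqnn.
have fy u z t : u \in N -> adj G u z -> f (u, z) t <= y t.
  move=> uN uz; rewrite /y (bigD1 u) //= (bigD1 z (P := fun z => adj G u z)) //=.
  by rewrite !leq_max leqnn !orbT.
have yE t : 0 < y t -> exists2 u, u \in N &
    t = u /\ y t = K \/ exists2 z, adj G u z & y t = f (u, z) t.
  move=> yt; have [u uN E] := bigmax_attained yt; exists u => //.
  move: E yt; rewrite -/(y t) => ->.
  case: (leqP (\max_(z | _) _)) => _; first by case: eqP => // ->; left.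
  by move=> /bigmax_attained[z uz E]; right; exists z.
exists y; split => //.
  move=> Y yY t yt degt; have [u uN [[tu ->]|[z uz E]]] := yE t yt.
    rewrite {t}tu in yt degt *.
    (* All neighbors of [u] get [K], and there are more than [D >= 2] of them. *)
    have three c : c <= K -> 2 < neighbor_count G (fun i => c <= Y i) u.
      move=> cK; apply: leq_trans (_ : degree G u <= _); first exact: leq_ltn_trans degt.
      apply/subset_leq_card/fintype.subsetP => z; rewrite !inE => uz.
      rewrite uz (leq_trans cK) //; apply: leq_trans (yY z).
      by apply: leq_trans (fy _ _ _ uN uz); have [[]] := fP (u, z) uz.
    by apply/andP; split; apply/implyP => _; [apply: ltnW|]; apply: three.
  rewrite E; have [[_ _ +] _] := fP (u, z) uz; apply => //.
  - by move=> i; apply: leq_trans (yY i); apply: fy.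
  - by rewrite -(yN u uN).
  - by rewrite -E.
apply: leq_trans (_ : #|\bigcup_(u in N) 
    (u |: \bigcup_(z | adj G u z) [set t | 0 < f (u, z) t])| <= _).
  apply/subset_leq_card/fintype.subsetP => t; rewrite inE => yt.
  have [u uN h] := yE t yt; apply/bigcupP; exists u => //; rewrite !inE.
  case: h => [[-> _]|[z uz E]]; first by rewrite eqxx.
  by apply/orP; right; apply/bigcupP; exists z; rewrite ?inE -?E.
apply: leq_trans (leq_card_bigcup _ _) _.
apply: leq_trans (_ : \sum_(u in N) (1 + D.+2 * B) <= _).
  apply: leq_sum => u _; apply: leq_trans (leq_card_setU _ _) _; rewrite cards1 leq_add2l.
  apply: leq_trans (leq_card_bigcup _ _) _.
  apply: leq_trans (_ : \sum_(z | adj G u z) B <= _).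
    by apply: leq_sum => z uz; have [_] := fP (u, z) uz.
  rewrite sum_nat_const leq_mul2r; apply/orP; right.
  by apply: leq_trans (degG u); rewrite cardsE.
rewrite sum_nat_const leq_mul2r; apply/orP; right.
apply: leq_trans (_ : #|v |: [set u | adj G v u]| <= _).
  by apply/subset_leq_card/fintype.subsetP => u; rewrite in_neighborhood1 !inE.
by apply: leq_trans (leq_card_setU _ _) _; rewrite cards1 add1n ltnS; exact: degG.
Qed.

End UpperBound.

(** * From a supply to a mend *)

Section Mend.
Variables (D K : nat) (s : nat -> nat) (n : nat) (G : graph n).
Hypotheses (K_gt0 : 0 < K) (s_le : forall j, s j <= j).

Let P := feeding D K s.

(** The mend takes the maximum of old and supplied labels and keeps all holes but [v]. Where the old
    label wins, the old verdict survives since labels only rise; where the supplied one wins, the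
    supply feeds it. *)
Lemma mend_of_supply (l : partial_labeling P n) (v : 'I_n) (y : 'I_n -> nat) :
  partial_solution G l -> hole l v -> (forall u, y u <= K) ->
  (forall u, u \in neighborhood G 1 v -> y u = K) ->
  (forall Y : 'I_n -> nat, (forall u, y u <= Y u) ->
     forall u, 0 < y u -> D < degree G u -> fed s G Y u (y u)) ->
  exists2 k, is_mend G l v k & changes l k <= #|[set u | 0 < y u]|.
Proof.
move=> lP lv yle yN yP.
pose lab (o : option 'I_K.+1) : nat := if o is Some i then i else 0.
pose Y u := maxn (lab (l u)) (y u).
have YK u : Y u < K.+1 by rewrite ltnS geq_max yle andbT; case: (l u) => //= i; rewrite -ltnS.
have vN : v \in neighborhood G 1 v by rewrite in_neighborhood1 eqxx.
pose k : partial_labeling P n :=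
  [ffun u => if hole l u && (u != v) then None else Some (inord (Y u))].
exists k; last first.
  apply/subset_leq_card/fintype.subsetP => u; rewrite !inE ffunE.
  apply: contraNltn; rewrite leqn0 => /eqP y0.
  have uv : u != v by apply: contra_eqN y0 => /eqP->; rewrite yN // -lt0n.
  rewrite /hole /Y y0 uv andbT maxn0; case: (l u) => //= i.
  by rewrite /= inord_val.
have kv : ~~ hole k v by rewrite /hole ffunE eqxx andbF.
split => //; last by move=> u /negbTE lu; rewrite /hole ffunE lu.
move=> w wk c kc; change (feeding_happy D s G c w).
have nk u : u \in neighborhood G 1 w -> ~~ hole l u || (u == v).
  move=> uw; move/existsPn/(_ u): wk; rewrite uw /= /hole ffunE.
  by case: ifP => // /negbT; rewrite negb_and negbK.
have cY u : u \in neighborhood G 1 w -> c u = Y u :> nat.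
  move=> uw; move: (kc u uw); rewrite ffunE.
  have := nk u uw; case: (hole l u) => /=.
    by move=> -> [<-]; rewrite inordK.
  by move=> _ [<-]; rewrite inordK.
have ww : w \in neighborhood G 1 w by rewrite in_neighborhood1 eqxx.
have fedY a : fed s G (fun u => c u) w a = fed s G Y w a.
  by rewrite /fed; congr ((_ ==> (_ <= _)) && (_ ==> (_ <= _)));
    apply: eq_in_neighbor_count => u wu; rewrite cY // in_neighborhood1 wu orbT.
have yY u : y u <= Y u by rewrite leq_maxr.
(* Only [v] has been filled, so a vertex that sees no hole any more either saw none before or lies
   in the ball around [v]. *)
have wvN : w \in neighborhood G 1 v \/ ~~ sees_hole G l w.
  have [|wv] := boolP (w \in neighborhood G 1 v); first by left.
  right; apply/existsPn => u; apply/negP => /andP[uw].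
  have := nk u uw; case: (hole l u) => //= /eqP uv _.
  by move: uw wv; rewrite uv !in_neighborhood1 adjC eq_sym => ->.
pose c0 : labeling 'I_K.+1 n := [ffun u => if l u is Some i then i else ord0].
have c0lab u : c0 u = lab (l u) :> nat by rewrite ffunE; case: (l u).
have lw : ~~ sees_hole G l w -> feeding_happy D s G c0 w.
  move=> nl; apply: (lP w nl c0) => u uw; rewrite ffunE.
  by move/existsPn/(_ u): nl; rewrite uw /= /hole; case: (l u).
apply/implyP => degw; rewrite fedY cY //; apply/andP; split.
  rewrite /Y; case: leqP => [_|ylt].
    have [y0|] := posnP (y w); last by move=> y0; apply: yP.
    rewrite y0 /fed ltnn /=; by have := s_le 0; rewrite leqn0 => /eqP->.
  case: wvN => [/yN yK|/lw].
    by have := YK w; rewrite /Y yK; move: ylt; rewrite yK; case: leqP; lia.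
  rewrite /feeding_happy degw /= => /andP[+ _].
  by rewrite c0lab; apply: fedS => u; rewrite c0lab leq_maxl.
apply/implyP => degw2; rewrite eqn_leq -ltnS YK /=.
case: wvN => [/yN yK|/lw]; first by rewrite -yK.
by rewrite /feeding_happy degw degw2 /= c0lab => /andP[_ /eqP <-]; rewrite leq_maxl.
Qed.

End Mend.

Lemma bigmin_leP (I : finType) (P : pred I) (F : I -> nat) n b :
  b <= n -> (forall i, P i -> b <= F i) -> b <= \big[minn/n]_(i | P i) F i.
Proof. by move=> bn bF; elim/big_ind: _ => // x z bx bz; rewrite leq_min bx. Qed.

Lemma bigmin_le_cond (I : finType) (P : pred I) (F : I -> nat) n i :
  P i -> \big[minn/n]_(i | P i) F i <= F i.
Proof.
move=> Pi; have := mem_index_enum i; elim: (index_enum I) => // j t IH.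
rewrite inE big_cons => /predU1P[<-|/IH le_t]; first by rewrite Pi geq_minl.
by case: ifP => // _; apply: leq_trans (geq_minr _ _) le_t.
Qed.

(** * Bounding the mending volume from both sides *)

Section Volume.
Variables (P : lcl) (n : nat).

Lemma mending_volume_le b :
  (forall (G : graph n) (l : partial_labeling P n) (v : 'I_n),
     inputs P G -> partial_solution G l -> hole l v ->
     exists2 k, is_mend G l v k & changes l k <= b) ->
  mending_volume P n <= b.
Proof.
move=> h; apply/bigmax_leqP => G /asboolP PG; apply/bigmax_leqP => l /asboolP lG.
apply/bigmax_leqP => v lv; have [k km kb] := h G l v PG lG lv.
by apply: leq_trans kb; apply: (bigmin_le_cond (fun k => changes l k)); apply/asboolP.
Qed.

Lemma leq_mending_volume b (G : graph n) (l : partial_labeling P n) (v : 'I_n) :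
  inputs P G -> partial_solution G l -> hole l v -> b <= n ->
  (forall k, is_mend G l v k -> b <= changes l k) ->
  b <= mending_volume P n.
Proof.
move=> PG lG lv bn h; rewrite /mending_volume.
rewrite (bigD1 G) /=; last exact/asboolP.
apply: leq_trans (leq_maxl _ _); rewrite (bigD1 l) /=; last exact/asboolP.
apply: leq_trans (leq_maxl _ _); rewrite (bigD1 v) //=.
apply: leq_trans (leq_maxl _ _); rewrite /mending_cost.
by apply: bigmin_leP => // k /asboolP; apply: h.
Qed.

End Volume.

(** * Lower bound *)

Lemma card_ord_interval n a b : #|[set u : 'I_n | a <= u < b]| = minn b n - a.
Proof.
rewrite -sum1_card (eq_bigl (fun u : 'I_n => a <= u < b)); last by move=> u; rewrite inE.
rewrite -(big_mkord (fun u => a <= u < b) (fun=> 1)).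
transitivity (\sum_(a <= u < minn b n) 1); last by rewrite sum_nat_const_nat muln1.
rewrite [RHS](big_nat_widen _ _ n) ?geq_minr // [RHS](big_nat_widenl _ 0) //.
apply: congr_big_nat => // u /andP[_ un].
by rewrite leq_min un andbT andbC.
Qed.

Section Heap.
Variables (D n : nat).
Hypothesis D_gt1 : 1 < D.

(* Vertex 0 has the D + 2 children 1, ..., D + 2; any other v has the D
   children D v + 3, ..., D v + D + 2. *)
Definition heap_child (u v : nat) : bool := (0 < v) && ((v - 3) %/ D == u).

Definition heap_edges : {set 'I_n.+1 * 'I_n.+1} :=
  [set e | heap_child (val e.1) (val e.2) || heap_child (val e.2) (val e.1)].

Lemma heap_child_lt u v : heap_child u v -> u < v.
Proof. by case/andP => v0 /eqP <-; have := leq_div (v - 3) D; lia. Qed.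

Lemma simple_heap : simple heap_edges.
Proof.
apply/andP; split; apply/forallP => u.
  by rewrite inE orbb; apply/negP => /heap_child_lt; rewrite ltnn.
by apply/forallP => v; rewrite !inE orbC.
Qed.

Definition heap : graph n.+1 := exist _ heap_edges simple_heap.

Lemma adj_heap u v : adj heap u v = heap_child u v || heap_child v u.
Proof. by rewrite /adj inE. Qed.

Lemma heap_parentE (u v : 'I_n.+1) : u < v -> adj heap u v -> (v - 3) %/ D = u.
Proof.
move=> uv; rewrite adj_heap => /orP[/andP[_ /eqP]//|/heap_child_lt].
by rewrite ltnNge ltnW.
Qed.

(** Smaller parents lead every vertex down to 0. On a cycle, both neighbors of the vertex of largest
    index would be smaller, hence both equal to its parent. *)
Lemma heap_tree : is_tree heap.
Proof.
split.
  split=> //.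
  have sym : connect_sym (adj heap) by apply: sym_connect_sym => u v; exact: adjC.
  have c0 v : connect (adj heap) v ord0.
    have [N] := ubnP (val v); elim: N => // N IH in v *; rewrite ltnS => vN.
    have [v0|v0] := posnP (val v).
      by have -> : v = ord0 by apply: val_inj.
    have pv : (v - 3) %/ D < n.+1.
      by apply: leq_ltn_trans (leq_div _ _) _; apply: leq_ltn_trans (leq_subr _ _) _.
    have ch : heap_child (Ordinal pv) v by rewrite /heap_child v0 eqxx.
    apply: connect_trans (connect1 _) (IH (Ordinal pv) _).
      by rewrite adj_heap ch orbT.
    exact: leq_trans (heap_child_lt ch) vN.
  by move=> u v; apply: connect_trans (c0 u) _; rewrite sym.
move=> c c2 /andP[cc uc].
have [x0 x0c] : exists x, x \in c.
  by case: c c2 {cc uc} => // x c _; exists x; rewrite mem_head.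
have [m mc mmax] := arg_maxnP (fun x : 'I_n.+1 => val x) x0c.
have [i c' E] := rot_to mc.
move: cc uc c2; rewrite -(rot_cycle i) -(rot_uniq i) -(size_rot i) E.
have lt_m x : x \in m :: c' -> adj heap x m -> x < m.
  rewrite -E mem_rot => /mmax /=; case: ltngtP => // /val_inj -> _.
  by rewrite adjxx.
case: c' {E} lt_m => [|x [|y c']] // lt_m.
rewrite /= rcons_path => /and4P[mx xy _ lm] /and4P[_ xc _ _] _.
rewrite adjC in mx.
have xm : x < m by apply: lt_m => //; rewrite !inE eqxx orbT.
have lm' : last y c' < m by apply: lt_m => //; rewrite 2!inE mem_last !orbT.
have := heap_parentE xm mx; rewrite (heap_parentE lm' lm) => /val_inj lx.
by move: xc; rewrite -lx mem_last.
Qed.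

Lemma heap_root_degree : degree heap ord0 = minn D.+3 n.+1 - 1.
Proof.
rewrite -card_ord_interval; apply: eq_card => u; rewrite !inE adj_heap orbC.
rewrite {1}/heap_child ltnn /= /heap_child; case: posnP => //= u0.
by rewrite eqn0Ngt divn_gt0; lia.
Qed.

Lemma heap_childE u v : 0 < u -> heap_child u v = (D * u + 3 <= v < D * u.+1 + 3).
Proof.
move=> u0; rewrite /heap_child eqn_leq leq_divRL; last by lia.
rewrite -[_ %/ _ <= u]ltnS ltn_divLR; lia.
Qed.

Lemma card_heap_children (u : nat) : 0 < u ->
  #|[set v : 'I_n.+1 | heap_child u v]| = minn (D * u.+1 + 3) n.+1 - (D * u + 3).
Proof.
by move=> u0; rewrite -card_ord_interval; apply: eq_card => v; rewrite !inE heap_childE.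
Qed.

Lemma card_heap_parents (P : pred 'I_n.+1) (v : 'I_n.+1) :
  #|[set u : 'I_n.+1 | heap_child u v & P u]| <= (0 < v).
Proof.
case: (posnP v) => v0.
  by rewrite eq_card0 // => u; rewrite inE /heap_child v0.
apply/card_le1_eqP => u u'; rewrite !inE.
move=> /andP[/andP[_ /eqP uE] _] /andP[/andP[_ /eqP +] _].
by rewrite uE => /val_inj.
Qed.

Lemma heap_degree_le (v : 'I_n.+1) : 0 < v -> degree heap v <= D.+1.
Proof.
move=> v0.
apply: leq_trans (_ : #|[set u : 'I_n.+1 | heap_child v u] :|:
                        [set u : 'I_n.+1 | heap_child u v & true]| <= _).
  by apply/subset_leq_card/fintype.subsetP => u; rewrite !inE andbT adj_heap.
apply: leq_trans (leq_card_setU _ _) _; rewrite -[D.+1]addn1 leq_add //.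
  by rewrite card_heap_children //; lia.
by apply: leq_trans (card_heap_parents _ _) _; case: ltnP.
Qed.

(** The hypothesis says that no child of [v] is cut off by the size of the heap. *)
Lemma heap_degree_ge (v : 'I_n.+1) : D * v.+1 + 3 <= n.+1 -> D < degree heap v.
Proof.
move=> vn; have [v0|v0] := posnP v.
  have -> : v = ord0 by apply: val_inj.
  by rewrite heap_root_degree; lia.
have pv : (v - 3) %/ D < n.+1.
  by apply: leq_ltn_trans (leq_div _ _) _; apply: leq_ltn_trans (leq_subr _ _) _.
have ch : heap_child (Ordinal pv) v by rewrite /heap_child v0 eqxx.
rewrite /degree (cardsD1 (Ordinal pv)) inE adj_heap ch orbT add1n ltnS.
apply: leq_trans (_ : #|[set u : 'I_n.+1 | heap_child v u]| <= _).
  by rewrite card_heap_children //; lia.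
apply/subset_leq_card/fintype.subsetP => u; rewrite !inE adj_heap => vu.
rewrite vu andbT; apply: contraTneq (heap_child_lt vu) => ->.
by rewrite -leqNgt ltnW // heap_child_lt.
Qed.

Lemma heap_max_degree : max_degree_le heap D.+2.
Proof.
move=> v; have [v0|/heap_degree_le/leqW//] := posnP v.
have -> : v = ord0 by apply: val_inj.
by rewrite -/(degree _ _) heap_root_degree; lia.
Qed.

(** * Growth of fed labels along the heap *)

Section Growth.
Variables (K : nat) (s : nat -> nat) (x : 'I_n.+1 -> nat).
Hypotheses (s_le : forall j, s j <= j) (x0 : x ord0 = K).
Hypothesis xfed : forall v, D < degree heap v -> fed s heap x v (x v).

Definition labels_below (b : nat) (P : pred nat) : nat :=
  #|[set u : 'I_n.+1 | (u < b) && P (x u)]|.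

(** At most one of the feeding neighbors is the parent, which leaves one child at level [x v] and
    two at level [s (x v)] when these levels are positive. *)
Lemma heap_children_fed j (v : 'I_n.+1) : 0 < j -> D < degree heap v ->
  (j <= x v) + (j <= s (x v)) <= #|[set w : 'I_n.+1 | heap_child v w & j <= x w]|.
Proof.
move=> j0 /xfed/andP[/implyP h1 /implyP h2].
have le c : j <= c ->
    neighbor_count heap (fun u => c <= x u) v <=
    #|[set w : 'I_n.+1 | heap_child v w & j <= x w]| + 1.
  move=> jc; apply: leq_trans (_ : #|[set w : 'I_n.+1 | heap_child v w & j <= x w] :|:
                        [set u : 'I_n.+1 | heap_child u v & true]| <= _).
    apply/subset_leq_card/fintype.subsetP => u; rewrite !inE adj_heap andbT.
    by move=> /andP[/orP[->|->] cu]; rewrite ?orbT // (leq_trans jc cu).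
  apply: leq_trans (leq_card_setU _ _) _; rewrite leq_add2l.
  by apply: leq_trans (card_heap_parents _ _) _; case: ltnP.
have [js|js] := leqP j (s (x v)).
  rewrite (leq_trans js (s_le _)); have := h2 (leq_trans j0 js).
  by move=> /leq_trans/(_ (le _ js)); rewrite addn1.
have [jx|//] := leqP j (x v).
by have := h1 (leq_trans j0 jx) => /leq_trans/(_ (le _ jx)); rewrite addn1 addn0.
Qed.

(** The children of the vertices below [b] lie below [D * b + 3], and distinct parents share no
    child. The root, being nobody's child, contributes the summand [j <= K]. *)
Lemma labels_below_step j b : 0 < j -> 0 < b -> D * b + 3 <= n.+1 ->
  (j <= K) + labels_below b (leq j) + labels_below b (fun c => j <= s c) <=
  labels_below (D * b + 3) (leq j).
Proof.
move=> j0 b0 bn.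
have sumE (P : pred nat) : labels_below b P = \sum_(u : 'I_n.+1 | u < b) P (x u).
  rewrite /labels_below -sum1_card big_mkcond [RHS]big_mkcond.
  by apply: eq_bigr => u _; rewrite inE; case: (_ < _); case: (P _).
have le : \sum_(u : 'I_n.+1 | u < b) #|[set w : 'I_n.+1 | heap_child u w & j <= x w]|
    <= #|[set w : 'I_n.+1 | (0 < w < D * b + 3) && (j <= x w)]|.
  under eq_bigr do rewrite -sum1_card.
  rewrite (exchange_big_dep (mem [set w : 'I_n.+1 | (0 < w < D * b + 3) && (j <= x w)])) /=.
    rewrite -[leqRHS]sum1_card; apply: leq_sum => w _; rewrite sum1_card.
    apply/card_le1_eqP => u u' /andP[_ +] /andP[_ +]; rewrite !inE.
    by move=> /andP[/andP[_ /eqP uE] _] /andP[/andP[_ /eqP +] _]; rewrite uE => /val_inj.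
  move=> u w ub; rewrite !inE => /andP[/andP[-> /eqP uw] ->]; rewrite andbT /=.
  by move: ub; rewrite -uw ltn_divLR; lia.
rewrite -addnA !sumE -big_split /=.
rewrite /labels_below (cardsD1 ord0) inE x0 addn_gt0 orbT /= leq_add2l.
apply: leq_trans (_ : #|[set w : 'I_n.+1 | (0 < w < D * b + 3) && (j <= x w)]| <= _).
  apply: leq_trans le; apply: leq_sum => u ub; apply: heap_children_fed => //.
  apply: heap_degree_ge; apply: leq_trans bn; rewrite leq_add2r leq_mul2l ub orbT //.
apply/subset_leq_card/fintype.subsetP => w; rewrite !inE => /andP[/andP[w0 ->] ->].
by rewrite !andbT; apply: contraTneq w0 => ->.
Qed.

End Growth.

(** Only the root has degree [D + 2], so 0 is allowed everywhere else, while a mend must put [K] at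
    the root. Every positive label of the mend is then a change. *)
Lemma heap_mending_volume (K : nat) (s : nat -> nat) b :
  (forall j, s j <= j) -> D.+2 <= n -> mendable (feeding D K s) ->
  (forall x : 'I_n.+1 -> nat, x ord0 = K ->
     (forall v, D < degree heap v -> fed s heap x v (x v)) ->
     b <= #|[set u | 0 < x u]|) ->
  b <= mending_volume (feeding D K s) n.+1.
Proof.
move=> s_le Dn mendP h.
pose l : partial_labeling (feeding D K s) n.+1 :=
  [ffun u => if u == ord0 then None else Some (ord0 : 'I_K.+1)].
have l0 : hole l ord0 by rewrite /hole ffunE.
have inp : inputs (feeding D K s) heap := conj heap_tree heap_max_degree.
have lP : partial_solution heap l.
  move=> v nv c cl.
  have vv : v \in neighborhood heap 1 v by rewrite in_neighborhood1 eqxx.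
  have v0 : v != ord0.
    by apply: contraNneq nv => v0; apply/existsP; exists v; rewrite vv v0.
  have cv : c v = 0 :> nat.
    by have := cl v vv; rewrite ffunE (negbTE v0) => /(congr1 (odflt ord0)) /= <-.
  apply/implyP => _; rewrite cv /= /fed ltnn /=; apply/andP; split.
    by have := s_le 0; rewrite leqn0 => /eqP->.
  by rewrite ltnNge heap_degree_le // lt0n.
have bk k : is_mend heap l ord0 k -> b <= changes l k.
  case=> kP k0 kl.
  have nh u : ~~ hole k u.
    by have [->//|u0] := eqVneq u ord0; apply: kl; rewrite /hole ffunE (negbTE u0).
  pose c : labeling 'I_K.+1 n.+1 := [ffun u => if k u is Some i then i else ord0].
  have kc u : k u = Some (c u) by move: (nh u); rewrite /hole ffunE; case: (k u).
  have happyc v : feeding_happy D s heap c v.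
    apply: (kP v _ c) => //; apply/existsPn => u; by rewrite (negbTE (nh u)) andbF.
  apply: leq_trans (h (fun u => c u) _ _) _.
  - have := happyc ord0; rewrite /feeding_happy heap_root_degree.
    rewrite (_ : D < _); last by lia.
    by rewrite (_ : D.+1 < _) /=; [case/andP => _ /eqP|lia].
  - by move=> v degv; have := happyc v; rewrite /feeding_happy degv /= => /andP[].
  apply/subset_leq_card/fintype.subsetP => u; rewrite !inE kc [l u]ffunE; case: (u == ord0) => //=.
  by apply: contraTneq => /(congr1 (odflt ord0)) /= <-.
(* The minimum in [mending_cost] starts from the number of vertices, so [b] must not exceed it; any
   mend shows this. *)
have [k km] := mendP _ _ _ _ inp lP l0.
apply: (leq_mending_volume inp lP l0) => [|//]; apply: leq_trans (bk k km) _.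
by rewrite -[leqRHS]card_ord max_card.
Qed.

End Heap.

(** * The two hierarchies *)

Lemma exists_two_smallest (I : finType) (Z : {set I}) (F : I -> nat) : 1 < #|Z| ->
  exists z1 z2, [/\ z1 \in Z, z2 \in Z, z1 != z2, F z1 <= F z2
    & forall z, z \in Z -> z != z1 -> F z2 <= F z].
Proof.
move=> Z1; have /card_gt0P[z0 z0Z] := ltnW Z1.
have minZ (A : {set I}) z : z \in A -> exists2 z', z' \in A & {in A, forall z, F z' <= F z}.
  by move=> zA; have [z'] := arg_minnP F zA; exists z'.
have [z1 z1Z min1] := minZ _ _ z0Z.
have /card_gt0P[z0' /minZ[z2 + min2]] : 0 < #|Z :\ z1| by move: Z1; rewrite (cardsD1 z1) z1Z.
rewrite !inE => /andP[z21 z2Z].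
exists z1, z2; split; rewrite ?(eq_sym z1) //; first exact: min1.
by move=> z zZ zz1; apply: min2; rewrite !inE zz1.
Qed.

Lemma sum_two_smallest (I : finType) (Z : {set I}) (F : I -> nat) z1 z2 :
  z1 \in Z -> (forall z, z \in Z -> z != z1 -> F z2 <= F z) ->
  F z1 + #|Z|.-1 * F z2 <= \sum_(z in Z) F z.
Proof.
move=> z1Z min2; rewrite (bigD1 z1) //= leq_add2l.
rewrite (cardsD1 z1) z1Z /= -sum_nat_const.
rewrite (eq_bigl (fun z => (z \in Z) && (z != z1))) => [|z]; last by rewrite !inE andbC.
by apply: leq_sum => z /andP[]; exact: min2.
Qed.

Section Volume.
Variables (D K : nat) (s : nat -> nat).
Variable Q : nat -> nat -> nat -> Prop.
Hypotheses (D_gt1 : 1 < D) (K_gt0 : 0 < K) (s_le : forall j, s j <= j).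
Hypothesis Q_zero : forall m, 0 < m -> Q 0 m 0.
Hypothesis Q_one : forall j m, 0 < j -> 0 < m -> Q j m 1.
Hypothesis Q_step : forall (I : finType) (Z : {set I}) (m : I -> nat)
    (W : I -> nat -> nat) j M,
  D <= #|Z| -> 0 < j <= K ->
  (forall z i, z \in Z -> i <= K -> Q i (m z) (W z i)) ->
  \sum_(z in Z) m z < M ->
  exists z1 z2, [/\ z1 \in Z, z2 \in Z, z1 != z2 & Q j M (W z1 j + W z2 (s j)).+1].

Lemma feeding_mend n B (G : graph n) (l : partial_labeling (feeding D K s) n) v :
  (forall m W, m <= n -> Q K m W -> W <= B) ->
  inputs (feeding D K s) G -> partial_solution G l -> hole l v ->
  exists2 k, is_mend G l v k & changes l k <= D.+3 * (1 + D.+2 * B).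
Proof.
move=> QB [[_ acyc] degG] lP lv.
have [y [y1 y2 y3 y4]] := @ball_supply D K s n G Q acyc degG D_gt1 s_le
  Q_zero Q_one (@Q_step 'I_n) B QB v.
have [k km kc] := mend_of_supply K_gt0 s_le lP lv y1 y2 y3.
by exists k => //; exact: leq_trans kc y4.
Qed.

End Volume.

Lemma labels_below_total n (x : 'I_n.+1 -> nat) b :
  labels_below x b (leq 1) <= #|[set u | 0 < x u]|.
Proof.
by apply/subset_leq_card/fintype.subsetP => u; rewrite !inE => /andP[].
Qed.

(** * Problems of volume [n ^ (1 / k)] *)

Section Root.
Variable k : nat.
Hypothesis k_gt0 : 0 < k.

Definition root_problem : lcl := feeding (2 ^ k) 1 id.

Let D_gt1 : 1 < 2 ^ k. Proof. by rewrite -(expn0 2) ltn_exp2l. Qed.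

(* Feeding one label from a branch with m vertices costs at most 2 m ^ (1/k) - 1. *)
Let Q (j m W : nat) : Prop := W.+1 ^ k <= 2 ^ k * m.

(** Let [a <= b] be the costs plus one of the two cheapest branches. All the other branches, at
    least [2 ^ k - 2], cost no less than the second, so the step reduces to [(a + b) ^ k <= a ^ k +
    (2 ^ k - 1) * b ^ k]. *)
Lemma root_problem_mend n B (G : graph n) (l : partial_labeling root_problem n) v :
  (forall W, W ^ k <= 2 ^ k * n -> W <= B) ->
  inputs root_problem G -> partial_solution G l -> hole l v ->
  exists2 k', is_mend G l v k' & changes l k' <= (2 ^ k).+3 * (1 + (2 ^ k).+2 * B).
Proof.
move=> WB; apply: (@feeding_mend _ _ _ Q) => //.
- by move=> m m0; rewrite /Q exp1n muln_gt0 expn_gt0.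
- by move=> j m _ m0; rewrite /Q leq_pmulr.
- move=> I Z m W j M DZ /andP[j0 j1] QZ sumM.
  have -> : j = 1 by lia.
  have [|z1 [z2 [z1Z z2Z z12 le12 min2]]] := @exists_two_smallest I Z (fun z => W z 1).
    exact: leq_trans DZ.
  exists z1, z2; split => //; rewrite /Q.
  apply: leq_trans (_ : 2 ^ k * \sum_(z in Z) m z <= _); last by rewrite leq_mul2l ltnW ?orbT.
  rewrite big_distrr /=.
  apply: leq_trans (_ : \sum_(z in Z) (W z 1).+1 ^ k <= _); last first.
    by apply: leq_sum => z zZ; exact: (QZ z 1).
  have min2' z : z \in Z -> z != z1 -> (W z2 1).+1 ^ k <= (W z 1).+1 ^ k.
    by move=> zZ zz1; rewrite leq_exp2r // ltnS min2.
  apply: leq_trans (sum_two_smallest (F := fun z => (W z 1).+1 ^ k) z1Z min2').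
  apply: leq_trans (_ : (W z1 1).+1 ^ k + (2 ^ k).-1 * (W z2 1).+1 ^ k <= _); last first.
    by rewrite leq_add2l leq_mul2r; apply/orP; right; move: DZ; case: #|Z|; lia.
  set a := (W z1 1).+1; set b := (W z2 1).+1.
  have -> : (W z1 1 + W z2 1).+2 = b + a by rewrite /a /b; lia.
  have ab : a <= b by [].
  (* In the binomial expansion the term [a ^ k] is split off; by [a <= b], the others are at most
     ['C(k, i) * b ^ k], with coefficients summing to [2 ^ k - 1]. *)
  have -> : (2 ^ k).-1 = \sum_(i < k) 'C(k, i).
    by rewrite -[2]/(1 + 1) expnDn big_ord_recr /= binn !exp1n !muln1 addn1 /=;
       apply: eq_bigr => i _; rewrite !exp1n !muln1.
  rewrite expnDn big_ord_recr /= subnn expn0 mul1n binn mul1n addnC leq_add2l.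
  rewrite big_distrl /=; apply: leq_sum => i _; rewrite leq_mul2l; apply/orP; right.
  rewrite -[in leqRHS](subnK (ltnW (ltn_ord i))) expnD leq_mul2l.
  by apply/orP; right; case: (val i) => // i'; rewrite leq_exp2r.
- move=> m W mn QW; apply: ltnW; apply: WB; apply: leq_trans QW _.
  by rewrite leq_mul2l mn orbT.
Qed.

Lemma root_problem_mendable : mendable root_problem.
Proof.
move=> n G l v inp lP lv.
have [|k' k'm _] := @root_problem_mend n (2 ^ k * n) G l v _ inp lP lv; last by exists k'.
by move=> W; apply: leq_trans; rewrite -{1}(expn1 W); case: W => // W; rewrite leq_pexp2l.
Qed.

(** [B] is the integer part of [2 * n ^ (1 / k)]. *)
Lemma root_problem_volume_le n : exists2 B, B ^ k <= 2 ^ k * n &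
  mending_volume root_problem n <= (2 ^ k).+3 * (1 + (2 ^ k).+2 * B).
Proof.
have WN W : W ^ k <= 2 ^ k * n -> W <= 2 ^ k * n.
  by apply: leq_trans; rewrite -{1}(expn1 W); case: W => // W; rewrite leq_pexp2l.
have ex0 : exists W, W ^ k <= 2 ^ k * n by exists 0; rewrite exp0n.
have [B Bn Bmax] := ex_maxnP ex0 WN.
by exists B => //; apply: mending_volume_le => G l v; apply: root_problem_mend.
Qed.

Lemma root_problem_volume_ge t n : 0 < t -> 4 * (2 ^ k) ^ t <= n ->
  2 ^ t <= mending_volume root_problem n.
Proof.
case: n => [|n] t_gt0 tn; first by move: tn; rewrite leqn0 muln_eq0 !expn_eq0.
apply: heap_mending_volume => //; last 1 first.
- move=> x x0 xfed.
  (* [b] counts the vertices of depth at most [t], starting from 1 and following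
     [b -> 2 ^ k * b + 3]; the 3 added in the invariant absorbs this constant. Each level at least
     doubles the count of positive labels. *)
  suff [b [b0 bD bx]] : exists b, [/\ 0 < b, b + 3 <= 4 * (2 ^ k) ^ t &
      2 ^ t <= labels_below x b (leq 1)].
    exact: leq_trans bx (labels_below_total _ _).
  elim: t tn {t_gt0} => [_|t IH tn].
    exists 1; split=> //; rewrite expn0 card_gt0; apply/set0Pn; exists ord0.
    by rewrite inE x0.
  have tn' : 4 * (2 ^ k) ^ t.+1 = 2 ^ k * (4 * (2 ^ k) ^ t) by rewrite expnS mulnCA.
  have [|b [b0 bD bx]] := IH.
    by apply: leq_trans tn; rewrite tn' leq_pmull // expn_gt0.
  have step : 2 ^ k * b + 3 + 3 <= 2 ^ k * (4 * (2 ^ k) ^ t).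
    apply: leq_trans (_ : 2 ^ k * (b + 3) <= _); last by rewrite leq_mul2l bD orbT.
    rewrite mulnDr -addnA leq_add2l; lia.
  exists (2 ^ k * b + 3); split; [lia|by rewrite tn'|].
  have := labels_below_step (fun j => leqnn j) x0 xfed (ltn0Sn 0) b0.
  have bn : 2 ^ k * b + 3 <= n.+1.
    by apply: leq_trans (leq_addr 3 _) _; apply: leq_trans step _; rewrite -tn'.
  move=> /(_ bn); apply: leq_trans; rewrite -addnA.
  by apply: leq_trans (leq_addl _ _); rewrite expnS mul2n -addnn leq_add.
- have := leq_trans (leq_mul (leqnn 4) (leq_pexp2l (ltnW D_gt1) t_gt0)) tn.
  by rewrite expn1 => h; lia.
- exact: root_problem_mendable.
Qed.

End Root.

(** * Problems of volume [log ^ K n] *)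

Section Log.
Variable K : nat.
Hypothesis K_gt0 : 0 < K.

Definition log_problem : lcl := feeding 3 K predn.

(* Feeding a label j from a branch with less than 2 ^ e vertices costs less
   than (e + 1) ^ j. *)
Let Q (j m W : nat) : Prop := forall e, m < 2 ^ e -> W < e.+1 ^ j.

(** The smallest branch receives [j] and the second smallest [j - 1]. Both have less than half of
    the allowed size, so the exponent drops by one and the step is
    [e ^ j + e ^ (j - 1) <= (e + 1) ^ j]. *)
Lemma log_problem_mend n e (G : graph n) (l : partial_labeling log_problem n) v :
  n < 2 ^ e -> inputs log_problem G -> partial_solution G l -> hole l v ->
  exists2 k, is_mend G l v k & changes l k <= 6 * (1 + 5 * e.+1 ^ K).
Proof.
move=> ne; apply: (@feeding_mend _ _ _ Q) => //.
- by move=> j; exact: leq_pred.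
- move=> j m j0 m0 [|e'].
    by rewrite expn0; lia.
  by move=> _; case: j j0 => // j _; rewrite expnS; have : 0 < e'.+2 ^ j; rewrite ?expn_gt0 //; nia.
- move=> I Z m W j M DZ /andP[j0 jK] QZ sumM.
  have [|z1 [z2 [z1Z z2Z z12 le12 min2]]] := @exists_two_smallest I Z m.
    exact: leq_trans DZ.
  exists z1, z2; split => // -[|e'].
    by rewrite expn0; lia.
  move=> Me.
  (* With [D = 3], at least two branches, [z2] included, are as large as [z2], so [2 * m z2] is
     below [2 ^ e'.+1]. *)
  have m2 : m z2 < 2 ^ e'.
    have := leq_trans (leq_ltn_trans (sum_two_smallest z1Z min2) sumM) (ltnW Me).
    have : 2 <= #|Z|.-1 by lia.
    by move: (_.-1) => c; rewrite expnS; nia.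
  have m1 : m z1 < 2 ^ e' by exact: leq_ltn_trans m2.
  have W1 := QZ z1 j z1Z jK e' m1.
  have W2 := QZ z2 j.-1 z2Z (leq_trans (leq_pred _) jK) e' m2.
  case: j j0 {jK} W1 W2 => // j _ /= W1 W2.
  apply: leq_trans (_ : e'.+1 ^ j.+1 + e'.+1 ^ j <= _); first by lia.
  rewrite !expnS -mulSnr leq_mul2l; apply/orP; right.
  by case: (j) => // j'; rewrite leq_exp2r.
- by move=> m W mn /(_ e (leq_ltn_trans mn ne)) /ltnW.
Qed.

Lemma log_problem_mendable : mendable log_problem.
Proof.
move=> n G l v inp lP lv.
by have [k km _] := log_problem_mend (ltn_expl n (ltnSn 1)) inp lP lv; exists k.
Qed.

Lemma log_problem_volume_le n e : n < 2 ^ e ->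
  mending_volume log_problem n <= 6 * (1 + 5 * e.+1 ^ K).
Proof. by move=> ne; apply: mending_volume_le => G l v; apply: log_problem_mend. Qed.

(** By Pascal's rule, at least ['C(t.+1, i.+1)] vertices of depth at most [t] have label at least
    [K - i]; [i = K - 1] counts the positive labels. *)
Lemma log_problem_volume_ge t n : 0 < t -> 4 * 3 ^ t <= n ->
  'C(t.+1, K) <= mending_volume log_problem n.
Proof.
case: n => [|n] t_gt0 tn; first by move: tn; rewrite leqn0 muln_eq0 expn_eq0.
apply: heap_mending_volume => //; last 1 first.
- move=> x x0 xfed.
  suff [b [b0 bD bx]] : exists b, [/\ 0 < b, b + 3 <= 4 * 3 ^ t &
      forall i, i < K -> 'C(t.+1, i.+1) <= labels_below x b (leq (K - i))].
    apply: leq_trans (labels_below_total _ b).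
    by have := bx K.-1; rewrite (_ : K - K.-1 = 1) ?prednK //; [apply|lia].
  elim: t tn {t_gt0} => [_|t IH tn].
    exists 1; split=> // -[_|i _]; last by rewrite bin_small.
    rewrite bin1 card_gt0; apply/set0Pn; exists ord0.
    by rewrite inE x0 subn0 leqnn.
  have [|b [b0 bD bx]] := IH.
    by apply: leq_trans tn; rewrite expnS; lia.
  exists (3 * b + 3); split; [lia|by rewrite expnS; lia|].
  move=> i iK.
  have := labels_below_step leq_pred x0 xfed (j := K - i) _ b0.
  rewrite subn_gt0 iK leq_subr => /(_ isT).
  have n3 : 3 * b + 3 <= n.+1 by apply: leq_trans tn; rewrite expnS; lia.
  move=> /(_ n3); apply: leq_trans; rewrite binS -addnA addnCA leq_add ?bx //.
  (* The second term of Pascal's rule is 1 for [i = 0], paid by the root; otherwise it counts labels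
     one level higher, whose predecessor still reaches [K - i]. *)
  case: i iK => [|i] iK; first by rewrite bin0.
  apply: leq_trans (bx i (ltnW iK)) _; apply: leq_trans (leq_addl _ _).
  apply/subset_leq_card/fintype.subsetP => u; rewrite !inE => /andP[->] /=.
  by move: (x u) => c; lia.
- by move=> j; exact: leq_pred.
- have := leq_trans (leq_mul (leqnn 4) (leq_pexp2l (ltn0Sn 2) t_gt0)) tn.
  by rewrite expn1 => h; lia.
- exact: log_problem_mendable.
Qed.

End Log.

(** * Asymptotics *)

(** Every factor [n - i] with [i < m] is at least [n + 1 - K]. *)
Lemma leq_exp_ffact K n m : m <= K -> (n.+1 - K) ^ m <= n ^_ m.
Proof.
elim: m => // m IH mK; rewrite expnSr ffactnSr leq_mul ?IH //; [exact: ltnW|lia].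
Qed.

Lemma trunc_log_quarter p n : 1 < p -> 4 <= n ->
  4 * p ^ trunc_log p (n %/ 4) <= n < 4 * p ^ (trunc_log p (n %/ 4)).+1.
Proof.
move=> p1 n4; have n0 : 0 < n %/ 4 by rewrite divn_gt0.
have := trunc_logP p1 n0; have := trunc_log_ltn (n %/ 4) p1.
move: (p ^ _) (p ^ _) => a b; have := divn_eq n 4; have := ltn_pmod n (d := 4) isT.
by lia.
Qed.

Import Order.TTheory GRing.Theory Num.Theory.

Local Open Scope classical_set_scope.
Local Open Scope ring_scope.

Section Asymptotics.
Variable R : realType.

Lemma eqTheta_eventually (f g : nat -> R) (c1 c2 : R) N : 0 < c1 -> 0 < c2 ->
  (forall n, (N <= n)%N -> [/\ 0 <= f n, 0 <= g n, c1 * g n <= f n & f n <= c2 * g n]) ->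
  (f : nat -> R^o) =Theta_\oo (g : nat -> R^o).
Proof.
move=> c10 c20 h; rewrite eqThetaE qualifE; apply/asboolP.
exists (c1, c2); first by rewrite /= c10.
exists N => // n /= Nn; have [f0 g0 h1 h2] := h n Nn.
by rewrite !ger0_norm.
Qed.

Lemma root_problem_theta k : (0 < k)%N ->
  tree_problem_with_volume (root_problem k) (fun n => n%:R `^ (k%:R^-1 : R)).
Proof.
move=> k0; split; [exact: on_trees_feeding|exact: root_problem_mendable|].
have kR : k%:R != 0 :> R by rewrite pnatr_eq0 -lt0n.
have rk n : (n%:R `^ (k%:R^-1 : R)) ^+ k = n%:R.
  by rewrite -powR_mulrn ?powR_ge0 // -powRrM mulVf // powRr1.
pose C : R := (2 ^ k).+3%:R * (1 + (2 ^ k).+2%:R * 2).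
(* The factor [8^-1] comes from [n < 4 * (2 ^ k) ^ t.+1 <= (8 * 2 ^ t) ^ k]; the threshold makes [t]
   positive. [C] combines [B <= 2 * n ^ (1 / k)] with [1 <= n ^ (1 / k)]. *)
apply: (@eqTheta_eventually _ _ (8^-1) C (4 * 2 ^ k)%N) => //.
  by rewrite mulr_gt0 // addr_gt0 // mulr_gt0.
move=> n nN; split; [by rewrite ler0n|exact: powR_ge0| |].
- have D1 : (1 < 2 ^ k)%N by rewrite -(expn0 2) ltn_exp2l.
  have n4 : (4 <= n)%N by apply: leq_trans nN; rewrite leq_pmulr // expn_gt0.
  have /andP[] := trunc_log_quarter D1 n4; set t := trunc_log _ _ => tn nt.
  have t0 : (0 < t)%N.
    rewrite lt0n; apply: contraTneq nN => tz; rewrite -ltnNge.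
    by move: nt; rewrite tz expn1.
  have := root_problem_volume_ge k0 t0 tn; rewrite -(ler_nat R); apply: le_trans.
  rewrite mulrC ler_pdivrMr //.
  rewrite -(@ler_pXn2r _ k) // ?nnegrE ?powR_ge0 // rk.
  rewrite -natrM -natrX ler_nat; apply: leq_trans (ltnW nt) _.
  have e8 : (4 * 2 ^ k <= 8 ^ k)%N.
    by rewrite (_ : 8 = 4 * 2)%N // expnMn leq_mul2r -{1}(expn1 4) leq_exp2l // k0 orbT.
  by rewrite expnMn expnS mulnA mulnC -!expnM (mulnC k) leq_mul2l e8 orbT.
have [B Bn] := root_problem_volume_le k0 n; rewrite -(ler_nat R) => /le_trans; apply.
rewrite natrM /C -mulrA ler_wpM2l // natrD natrM.
have r1 : 1 <= n%:R `^ (k%:R^-1 : R).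
  rewrite -(@ler_pXn2r _ k) // ?nnegrE ?powR_ge0 // expr1n rk ler1n.
  by apply: leq_trans nN; rewrite muln_gt0 expn_gt0.
have Br : B%:R <= 2 * n%:R `^ (k%:R^-1 : R).
  rewrite -(@ler_pXn2r _ k) // ?nnegrE ?mulr_ge0 ?powR_ge0 // exprMn rk.
  by rewrite -!natrX -natrM ler_nat.
by rewrite [leRHS]mulrDl mul1r -mulrA; apply: lerD => //; apply: ler_wpM2l.
Qed.

Lemma log_problem_theta K : (0 < K)%N ->
  tree_problem_with_volume (log_problem K) (fun n => (ln n%:R : R) ^+ K).
Proof.
move=> K0; split; [exact: on_trees_feeding|exact: log_problem_mendable|].
have ln2 : 0 < ln 2 :> R by rewrite ln_gt0 // ltr1n.
have ln3 : 0 < ln 3 :> R by rewrite ln_gt0 // ltr1n.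
pose c : R := (3 * ln 3) ^+ K * K`!%:R.
have c0 : 0 < c by rewrite mulr_gt0 ?exprn_gt0 ?mulr_gt0 // ltr0n fact_gt0.
(* With [e] the integer part of the binary logarithm, [e + 2 <= 3 * e] and
   [6 * (1 + 5 * X) <= 36 * X] for [X = (3 * e) ^ K]. *)
pose C : R := 36 * (3 / ln 2) ^+ K.
apply: (@eqTheta_eventually _ _ c^-1 C (4 * 3 ^ (2 * K))%N).
- by rewrite invr_gt0.
- by rewrite mulr_gt0 // exprn_gt0 // divr_gt0.
move=> n nN.
have n4 : (4 <= n)%N by apply: leq_trans nN; rewrite leq_pmulr // expn_gt0.
have L0 : 0 <= ln n%:R :> R by rewrite ln_ge0 // ler1n; lia.
have n0 : 0 < n%:R :> R by rewrite ltr0n; lia.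
split; [by rewrite ler0n|exact: exprn_ge0| |].
- have /andP[] := trunc_log_quarter (ltnW (ltnSn 2)) n4; set t := trunc_log _ _ => tn nt.
  have tK : (2 * K <= t)%N.
    rewrite -ltnS -(@ltn_exp2l 3) // -(@ltn_pmul2l 4) //.
    exact: leq_ltn_trans nt.
  have t0 : (0 < t)%N by lia.
  have := log_problem_volume_ge K0 t0 tn; rewrite -(ler_nat R); apply: le_trans.
  rewrite mulrC ler_pdivrMr // /c.
  have L : ln n%:R <= t.+3%:R * ln 3 :> R.
    rewrite mulr_natl -lnXn // ler_ln ?posrE // ?exprn_gt0 //.
    rewrite -natrX ler_nat; apply: leq_trans (ltnW nt) _.
    by rewrite !expnS; lia.
  apply: le_trans (_ : (t.+3%:R * ln 3) ^+ K <= _).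
    by rewrite lerXn2r // nnegrE // mulr_ge0 // ltW.
  rewrite !exprMn [leRHS](_ : _ = (3 ^ K * ('C(t.+1, K) * K`!))%:R * ln 3 ^+ K); last first.
    by rewrite !natrM natrX; ring.
  apply: ler_wpM2r; first by rewrite exprn_ge0 // ltW.
  rewrite -natrX ler_nat bin_ffact.
  apply: leq_trans (leq_mul (leqnn _) (leq_exp_ffact t.+1 (leqnn K))).
  by rewrite -expnMn leq_exp2r //; lia.
pose e := trunc_log 2 n.
have en : (2 ^ e <= n)%N by rewrite trunc_logP //; lia.
have ne : (n < 2 ^ e.+1)%N by rewrite trunc_log_ltn.
have e1 : (0 < e)%N.
  by rewrite lt0n; apply: contraTneq ne => ->; rewrite -leqNgt expn1; lia.
have := log_problem_volume_le K0 ne; rewrite -(ler_nat R) => /le_trans; apply.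
have eL : e%:R * ln 2 <= ln n%:R :> R.
  by rewrite mulr_natl -lnXn // ler_ln ?posrE ?exprn_gt0 // -natrX ler_nat.
apply: le_trans (_ : (36 * (3 * e) ^ K)%:R <= _).
  rewrite ler_nat; apply: leq_trans (_ : 6 * (1 + 5 * (3 * e) ^ K) <= _)%N.
    by rewrite leq_mul2l leq_add2l leq_mul2l leq_exp2r //; lia.
  by have : (0 < (3 * e) ^ K)%N; [rewrite expn_gt0 muln_gt0 e1|lia].
rewrite natrM natrX /C -mulrA ler_wpM2l // -exprMn lerXn2r ?nnegrE //.
  by rewrite mulr_ge0 // divr_ge0 // ltW.
by rewrite natrM -mulrA ler_wpM2l // mulrC ler_pdivlMr.
Qed.

End Asymptotics.

Lemma infinite_set_injective T (A : set T) (f : nat -> T) :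
  (forall n, A (f n)) -> injective f -> infinite_set A.
Proof.
move=> Af finj; apply/infiniteP.
have [g] : $|{injfun [set: nat] >-> A}|.
  by apply/injfunPex; exists f => [n _|m n _ _ /finj].
exact: inj_card_le g.
Qed.

Theorem mainTheorem1 (R : realType) :
  infinite_set [set a : R | 0 < a <= 1 /\
    exists P : lcl, tree_problem_with_volume P (fun n => n%:R `^ a)] /\
  infinite_set [set k : nat | (1 <= k)%N /\
    exists P : lcl, tree_problem_with_volume P (fun n => (ln n%:R : R) ^+ k)].
Proof.
split.
  apply: (@infinite_set_injective _ _ (fun k => k.+1%:R^-1)) => [k|i j].
    split; first by rewrite invr_gt0 ltr0n /= invf_le1 ?ltr0n // ler1n.
    by exists (root_problem k.+1); exact: root_problem_theta.
  by move=> /invr_inj /eqP; rewrite eqr_nat => /eqP[].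
apply: (@infinite_set_injective _ _ S) => [k|i j []//]; split=> //.
by exists (log_problem k.+1); exact: log_problem_theta.
Qed.
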